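(* There is an absolute constant $C>0$ such that the following holds. Let $R>0$, let $\{\xi_k\}$ be a finite set of points of $\mathbb{R}^2$ lying on the circle $\{\xi\in\mathbb{R}^2:\ \|\xi\|=R\}$, and let $$M:=\sup_j \#\{k:\ \|\xi_k-\xi_j\|\le R^{1/2}\}.$$ Then for every choice of complex coefficients $\{a_k\}$, $$\sup_{Q}\left(\int_{Q}\Big|\sum_k a_k e^{2\pi i\,\xi_k\cdot x}\Big|^4\,dx\right)^{1/4}\le C\,M^{1/2}\Big(\sum_k |a_k|^2\Big)^{1/2},$$ where the supremum is taken over all squares $Q\subset\mathbb{R}^2$ of Lebesgue measure $1$ and $dx$ is Lebesgue measure. In particular $C$ does not depend on $R$, on the points $\xi_k$, or on the coefficients. *)

(* Defs.v *)
From Stdlib Require Import Reals Lra List ClassicalEpsilon.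
Import ListNotations.
Open Scope R_scope.

Definition rsum (n : nat) (f : nat -> R) : R :=
  fold_right Rplus 0 (map f (seq 0 n)).

Definition norm2 (p : R * R) : R := sqrt (fst p ^ 2 + snd p ^ 2).
Definition dist2 (p q : R * R) : R :=
  sqrt ((fst p - fst q) ^ 2 + (snd p - snd q) ^ 2).

(* Riemann integral over [0,1] of f (total: 0 if f is not integrable;
   the value does not depend on the integrability proof chosen). *)
Definition RInt01 (f : R -> R) : R :=
  match excluded_middle_informative (inhabited (Riemann_integrable f 0 1)) with
  | left h => RiemannInt (epsilon h (fun _ => True))
  | right _ => 0
  end.

(* Integral over the square Q = { c + s1 e1 + s2 e2 : s1,s2 in [0,1] },
   e1 = (cos t, sin t), e2 = (-sin t, cos t): an arbitrary square of area 1
   (centre/corner c, orientation t).  The parametrisation has Jacobian 1, so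
   this iterated integral equals the Lebesgue integral over Q for continuous F. *)
Definition square_integral (F : R -> R -> R) (c1 c2 t : R) : R :=
  RInt01 (fun s2 => RInt01 (fun s1 =>
    F (c1 + s1 * cos t - s2 * sin t) (c2 + s1 * sin t + s2 * cos t))).

(* |sum_{k<n} a_k e^{2 pi i xi_k . x}|^4 with a_k = u k + i v k *)
Definition phase (xi : nat -> R * R) (k : nat) (x1 x2 : R) : R :=
  2 * PI * (fst (xi k) * x1 + snd (xi k) * x2).
Definition expsum_re (n : nat) (xi : nat -> R * R) (u v : nat -> R) (x1 x2 : R) : R :=
  rsum n (fun k => u k * cos (phase xi k x1 x2) - v k * sin (phase xi k x1 x2)).
Definition expsum_im (n : nat) (xi : nat -> R * R) (u v : nat -> R) (x1 x2 : R) : R :=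
  rsum n (fun k => u k * sin (phase xi k x1 x2) + v k * cos (phase xi k x1 x2)).
Definition expsum_abs4 (n : nat) (xi : nat -> R * R) (u v : nat -> R) (x1 x2 : R) : R :=
  (expsum_re n xi u v x1 x2 ^ 2 + expsum_im n xi u v x1 x2 ^ 2) ^ 2.

Definition cap_count (n : nat) (xi : nat -> R * R) (r : R) (j : nat) : nat :=
  length (filter (fun k => if Rle_dec (dist2 (xi k) (xi j)) r then true else false)
                 (seq 0 n)).

Definition maxcap (n : nat) (xi : nat -> R * R) (Rad : R) : nat :=
  fold_right Nat.max 0%nat (map (cap_count n xi (sqrt Rad)) (seq 0 n)).

(* Main.v *)
Require Import Defs.
From Stdlib Require Import Reals Lra Lia List ClassicalEpsilon.
From Coquelicot Require Import Coquelicot.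
Import ListNotations.
Open Scope R_scope.

(** Split the circle into four quarter circles; up to the factor [64] it is enough to bound
    [int |f|^4] when all frequencies lie on one of them.  Dominate the indicator of the square
    by the tensor product of [W(s) = (2 + s - s^2)^2] on [[-1, 2]], whose Fourier transform is
    [O(1 / (1 + w^2))].  Expanding [|f|^4] gives a quadratic form in the products [a_j a_k] with
    kernel at most a constant times [1 / (1 + |d|^2)], [d = xi_l + xi_m - xi_j - xi_k].  Two
    points of a quarter circle are determined by their sum, quantitatively
    [|xi_l - xi_j| |xi_l - xi_k| <= 3 R |d|], and likewise for [xi_m].  Hence the kernel is
    bounded by a product of a function of [l] and a function of [m], each of which decays like
    [1 / (1 + dist^2 / R)] away from [xi_j] and [xi_k] and so sums to [O(M)].  Schur's test
    concludes. *)

(** * Finite sums over lists, and Schur's test *)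

(** [rsum n] is convertible to [lsum (seq 0 n)]. Arbitrary lists serve as index sets because the
    proof also sums over quarter circles and over pairs and quadruples of indices. *)
Definition lsum {A : Type} (l : list A) (f : A -> R) : R :=
  fold_right Rplus 0 (map f l).

Lemma lsum_cons {A} (a : A) l f : lsum (a :: l) f = f a + lsum l f.
Proof. reflexivity. Qed.

Lemma lsum_app {A} (l l' : list A) f : lsum (l ++ l') f = lsum l f + lsum l' f.
Proof.
  induction l as [|a l IH]; simpl app.
  - unfold lsum at 2; simpl; ring.
  - rewrite !lsum_cons, IH; ring.
Qed.

Lemma lsum_ext {A} (l : list A) f g :
  (forall x, In x l -> f x = g x) -> lsum l f = lsum l g.
Proof.
  intros H; unfold lsum; f_equal; apply map_ext_in; exact H.
Qed.

Lemma lsum_le {A} (l : list A) f g :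
  (forall x, In x l -> f x <= g x) -> lsum l f <= lsum l g.
Proof.
  induction l as [|a l IH]; intros H; [unfold lsum; simpl; lra|].
  rewrite !lsum_cons; apply Rplus_le_compat; [apply H; now left|].
  apply IH; intros x Hx; apply H; now right.
Qed.

Lemma lsum_0 {A} (l : list A) : lsum l (fun _ => 0) = 0.
Proof. induction l as [|a l IH]; [reflexivity|rewrite lsum_cons, IH; ring]. Qed.

Lemma lsum_nonneg {A} (l : list A) f : (forall x, In x l -> 0 <= f x) -> 0 <= lsum l f.
Proof. intros H; rewrite <- (lsum_0 l); now apply lsum_le. Qed.

Lemma lsum_plus {A} (l : list A) f g :
  lsum l (fun x => f x + g x) = lsum l f + lsum l g.
Proof.
  induction l as [|a l IH]; [unfold lsum; simpl; ring|].
  rewrite !lsum_cons, IH; ring.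
Qed.

Lemma lsum_scal {A} (l : list A) c f : lsum l (fun x => c * f x) = c * lsum l f.
Proof.
  induction l as [|a l IH]; [unfold lsum; simpl; ring|].
  rewrite !lsum_cons, IH; ring.
Qed.

Lemma lsum_map {A B} (h : A -> B) (l : list A) f :
  lsum (map h l) f = lsum l (fun x => f (h x)).
Proof. unfold lsum; now rewrite map_map. Qed.

Lemma lsum_prod {A B} (l : list A) (l' : list B) f :
  lsum (list_prod l l') f = lsum l (fun x => lsum l' (fun y => f (x, y))).
Proof.
  induction l as [|a l IH]; [reflexivity|].
  simpl list_prod; rewrite lsum_app, lsum_cons, IH, lsum_map; reflexivity.
Qed.

Lemma lsum_mul {A B} (l : list A) (l' : list B) f g :
  lsum l f * lsum l' g = lsum (list_prod l l') (fun p => f (fst p) * g (snd p)).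
Proof.
  rewrite lsum_prod; simpl.
  rewrite Rmult_comm, <- lsum_scal; apply lsum_ext; intros x _.
  rewrite lsum_scal; ring.
Qed.

Lemma lsum_swap {A B} (l : list A) (l' : list B) f :
  lsum l (fun x => lsum l' (fun y => f x y)) = lsum l' (fun y => lsum l (fun x => f x y)).
Proof.
  induction l as [|a l IH].
  - symmetry; apply (lsum_0 l').
  - rewrite lsum_cons, IH, <- lsum_plus; reflexivity.
Qed.

Lemma lsum_filter {A} (b : A -> bool) (l : list A) f :
  lsum l f = lsum (filter b l) f + lsum (filter (fun x => negb (b x)) l) f.
Proof.
  induction l as [|a l IH]; [unfold lsum; simpl; ring|].
  simpl; destruct (b a); simpl; rewrite !lsum_cons, IH; ring.
Qed.

Lemma lsum_filter_le {A} (b : A -> bool) (l : list A) f :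
  (forall x, In x l -> 0 <= f x) -> lsum (filter b l) f <= lsum l f.
Proof.
  intros H; rewrite (lsum_filter b l).
  assert (0 <= lsum (filter (fun x => negb (b x)) l) f); [|lra].
  apply lsum_nonneg; intros x Hx; apply H; now apply filter_In in Hx.
Qed.

Lemma lsum_indicator {A} (b : A -> bool) (l : list A) :
  lsum l (fun x => if b x then 1 else 0) = INR (length (filter b l)).
Proof.
  induction l as [|a l IH]; [reflexivity|].
  rewrite lsum_cons, IH; simpl filter; destruct (b a); simpl length; [rewrite S_INR|]; ring.
Qed.

(** By [r p * r q <= (r p ^ 2 + r q ^ 2) / 2] the form is at most the mean of two sums, which
    coincide by symmetry of [K]; the row sum bound applies to either. *)
Lemma schur_test {A} (l : list A) (r : A -> R) (K : A -> A -> R) B :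
  (forall p q, In p l -> In q l -> 0 <= K p q) ->
  (forall p q, K p q = K q p) ->
  (forall p, In p l -> lsum l (K p) <= B) ->
  lsum l (fun p => lsum l (fun q => r p * r q * K p q)) <= B * lsum l (fun p => r p ^ 2).
Proof.
  intros HK Hs HB.
  set (D := lsum l (fun p => lsum l (fun q => r p ^ 2 * K p q))).
  assert (HD : D <= B * lsum l (fun p => r p ^ 2)).
  { unfold D; rewrite <- lsum_scal; apply lsum_le; intros p Hp.
    rewrite lsum_scal, Rmult_comm; apply Rmult_le_compat_r; [apply pow2_ge_0|now apply HB]. }
  assert (HD' : D = lsum l (fun p => lsum l (fun q => r q ^ 2 * K p q))).
  { unfold D; rewrite lsum_swap; apply lsum_ext; intros q _; apply lsum_ext; intros p _.
    now rewrite Hs. }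
  apply Rle_trans with (/ 2 * D + / 2 * D); [|lra].
  rewrite HD' at 2; unfold D; rewrite <- !lsum_scal, <- lsum_plus.
  apply lsum_le; intros p Hp; rewrite <- !lsum_scal, <- lsum_plus.
  apply lsum_le; intros q Hq.
  specialize (HK p q Hp Hq).
  assert (0 <= (r p - r q) ^ 2 * K p q) by (apply Rmult_le_pos; [apply pow2_ge_0|easy]).
  lra.
Qed.

(** * Summing [1 / (1 + x^2)] over points of bounded local density *)

Definition itv (a b x : R) : bool :=
  if Rle_dec a x then if Rle_dec x b then true else false else false.

Lemma itvP a b x : itv a b x = true <-> a <= x <= b.
Proof. unfold itv; destruct (Rle_dec a x), (Rle_dec x b); split; intros; try easy; lra. Qed.

Lemma lsum_single {A} (a : A) f : lsum [a] f = f a.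
Proof. unfold lsum; simpl; ring. Qed.

(** The term [/ (INR N + / 2)] makes the induction close: [1 + (x + 1)^2] exceeds
    [(x + 1/2) (x + 3/2)], whose inverse telescopes. At [N = 0] there is equality. *)
Lemma sum_inv_squares (N : nat) :
  lsum (seq 0 (S N)) (fun i => / (1 + INR i ^ 2)) <= 3 - / (INR N + / 2).
Proof.
  induction N as [|N IH].
  - unfold lsum; simpl; lra.
  - rewrite seq_S, lsum_app, lsum_single, Nat.add_0_l, S_INR.
    pose proof (pos_INR N) as H; set (x := INR N) in *.
    assert (/ (1 + (x + 1) ^ 2) <= / (x + / 2) - / (x + 1 + / 2)); [|lra].
    replace (/ (x + / 2) - / (x + 1 + / 2)) with (/ ((x + / 2) * (x + 1 + / 2)))
      by (field; lra).
    apply Rinv_le_contravar; nra.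
Qed.

Lemma finite_bound {A} (l : list A) (f : A -> R) :
  exists N : nat, forall k, In k l -> f k < INR N.
Proof.
  induction l as [|a l [N HN]]; [now exists 0%nat|].
  destruct (INR_unbounded (f a)) as [N' HN'].
  exists (Nat.max N N'); intros k [<-|Hk].
  - apply Rlt_le_trans with (1 := HN'), le_INR; lia.
  - apply Rlt_le_trans with (1 := HN k Hk), le_INR; lia.
Qed.

(** Cut the half-line from [c] into bins of length [h]. On the bin with index [i] the summand is at
    most [1 / (1 + i^2)], and each bin holds at most [M] points. [Hbin] adds the bins one at a
    time. *)
Lemma lsum_one_sided {A} (l : list A) (tau : A -> R) (c h M : R) :
  0 < h -> 0 <= M ->
  (forall a, lsum l (fun k => if itv a (a + h) (tau k) then 1 else 0) <= M) ->
  lsum l (fun k => if Rle_dec c (tau k) then / (1 + ((tau k - c) / h) ^ 2) else 0) <= 3 * M.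
Proof.
  intros Hh HM H.
  assert (Hpos : forall x, 0 < / (1 + x ^ 2))
    by (intros x; apply Rinv_0_lt_compat; pose proof (pow2_ge_0 x); lra).
  assert (Hbin : forall N,
    lsum l (fun k => if Rle_dec c (tau k) then
              if Rlt_dec (tau k) (c + INR N * h) then / (1 + ((tau k - c) / h) ^ 2) else 0
            else 0)
    <= M * lsum (seq 0 N) (fun i => / (1 + INR i ^ 2))).
  { induction N as [|N IH].
    - change (lsum (seq 0 0) _) with 0; rewrite Rmult_0_r.
      apply Rle_trans with (2 := Req_le _ _ (lsum_0 l)), lsum_le; intros k _; simpl INR.
      destruct (Rle_dec c (tau k)), (Rlt_dec (tau k) (c + 0 * h)); lra.
    - rewrite seq_S, lsum_app, lsum_single, Nat.add_0_l, Rmult_plus_distr_l.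
      eapply Rle_trans; [|apply Rplus_le_compat; [exact IH|]].
      2:{ rewrite Rmult_comm; apply Rmult_le_compat_l; [apply Rlt_le, Hpos|].
          apply (H (c + INR N * h)). }
      rewrite <- lsum_scal, <- lsum_plus; apply lsum_le; intros k _.
      rewrite S_INR.
      destruct (itv _ _ (tau k)) eqn:E.
      + apply itvP in E.
        assert (HN : INR N <= (tau k - c) / h)
          by (apply Rle_div_r; lra).
        assert (/ (1 + ((tau k - c) / h) ^ 2) <= / (1 + INR N ^ 2)).
        { pose proof (pos_INR N).
          apply Rinv_le_contravar; [|apply Rplus_le_compat_l, pow_incr; lra].
          pose proof (pow2_ge_0 (INR N)); lra. }
        pose proof (Hpos (INR N)); pose proof (Hpos ((tau k - c) / h)).
        destruct (Rle_dec c (tau k)); [|lra].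
        destruct (Rlt_dec (tau k) (c + INR N * h)), (Rlt_dec (tau k) (c + (INR N + 1) * h)); lra.
      + assert (E' : ~ (c + INR N * h <= tau k <= c + INR N * h + h))
          by (rewrite <- itvP, E; easy).
        destruct (Rle_dec c (tau k)); [|lra].
        destruct (Rlt_dec (tau k) (c + INR N * h)), (Rlt_dec (tau k) (c + (INR N + 1) * h));
          lra. }
  (* The list is finite, so after enough bins the truncation in [Hbin] discards no point. *)
  destruct (finite_bound l (fun k => (tau k - c) / h)) as [N HN].
  specialize (Hbin (S N)); pose proof (sum_inv_squares N) as HS.
  assert (0 < / (INR N + / 2)) by (apply Rinv_0_lt_compat; pose proof (pos_INR N); lra).
  assert (HM3 : M * lsum (seq 0 (S N)) (fun i => / (1 + INR i ^ 2)) <= M * 3)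
    by (apply Rmult_le_compat_l; lra).
  rewrite (Rmult_comm 3); apply Rle_trans with (2 := HM3), Rle_trans with (2 := Hbin), lsum_le.
  intros k Hk.
  destruct (Rle_dec c (tau k)); [|lra].
  destruct (Rlt_dec (tau k) (c + INR (S N) * h)) as [_|H']; [lra|exfalso; apply H'].
  specialize (HN k Hk); apply Rlt_div_l in HN; [|easy]; rewrite S_INR; lra.
Qed.

(** The points left of [c] become points right of [- c] under [tau -> - tau], which maps windows to
    windows. Points at [c] are counted twice, which only enlarges the bound. *)
Lemma lsum_two_sided {A} (l : list A) (tau : A -> R) (c h M : R) :
  0 < h -> 0 <= M ->
  (forall a, lsum l (fun k => if itv a (a + h) (tau k) then 1 else 0) <= M) ->
  lsum l (fun k => / (1 + ((tau k - c) / h) ^ 2)) <= 6 * M.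
Proof.
  intros Hh HM H.
  pose proof (lsum_one_sided l tau c h M Hh HM H) as H1.
  assert (H2 := lsum_one_sided l (fun k => - tau k) (- c) h M Hh HM).
  assert (Hpos : forall x, 0 < / (1 + x ^ 2))
    by (intros x; apply Rinv_0_lt_compat; pose proof (pow2_ge_0 x); lra).
  eapply Rle_trans; [|replace (6 * M) with (3 * M + 3 * M) by ring;
    apply Rplus_le_compat; [exact H1|apply H2]].
  - rewrite <- lsum_plus; apply lsum_le; intros k _.
    replace ((- tau k - - c) / h) with (- ((tau k - c) / h)) by (field; lra).
    replace ((- ((tau k - c) / h)) ^ 2) with (((tau k - c) / h) ^ 2) by ring.
    pose proof (Hpos ((tau k - c) / h)).
    destruct (Rle_dec c (tau k)), (Rle_dec (- c) (- tau k)); lra.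
  - intros a; apply Rle_trans with (2 := H (- a - h)), Req_le, lsum_ext; intros k _.
    destruct (itv a (a + h) (- tau k)) eqn:E, (itv (- a - h) (- a - h + h) (tau k)) eqn:E';
      try easy; exfalso.
    + apply itvP in E; assert (itv (- a - h) (- a - h + h) (tau k) = true)
        by (apply itvP; lra); congruence.
    + apply itvP in E'; assert (itv a (a + h) (- tau k) = true)
        by (apply itvP; lra); congruence.
Qed.

(** * Pairs of points on a circle with nearly equal sums *)

Lemma Cmod_sqr (z : C) : Cmod z ^ 2 = fst z ^ 2 + snd z ^ 2.
Proof. exact (Cmod2_alt z). Qed.

(* On the circle [conj z = rho^2 / z], hence the sum of two points determines their product
   and therefore, stably as long as the sum is not small, the two points. *)
Lemma circle_pairs_close (rho : R) (zj zk zl zm : C) :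
  Cmod zj = rho -> Cmod zk = rho -> Cmod zl = rho -> Cmod zm = rho ->
  Cmod (zj + zk) * (Cmod (zl - zj) * Cmod (zl - zk)) <=
  4 * rho ^ 2 * Cmod (zl + zm - (zj + zk)).
Proof.
  intros Hj Hk Hl Hm.
  set (s := (zj + zk)%C); set (d := (zl + zm - s)%C).
  assert (Hc : forall z, Cmod z = rho -> (z * Cconj z)%C = RtoC (rho ^ 2))
    by (intros z <-; now rewrite <- Cmod2_conj).
  (* On the circle [zj zk conj (zj + zk) = rho^2 (zj + zk)], and likewise for [zl], [zm]. Expanding
     with [zl + zm = s + d], the terms free of [d] and [conj d] cancel. The three remaining terms
     have moduli at most [2], [1] and [1] times [rho^2 |d|]. *)
  assert (E : ((zl - zj) * (zl - zk) * Cconj s =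
    d * (zl * Cconj s) + (- (d * RtoC (rho ^ 2)) + zl * zm * Cconj d))%C).
  { unfold d, s; rewrite ?Cminus_conj, ?Cplus_conj.
    pose proof (Hc _ Hj) as Ej; pose proof (Hc _ Hk) as Ek;
    pose proof (Hc _ Hl) as El; pose proof (Hc _ Hm) as Em.
    set (P := RtoC (rho ^ 2)) in *.
    replace (zl * zm * (Cconj zl + Cconj zm - (Cconj zj + Cconj zk)))%C
      with (zm * (zl * Cconj zl) + zl * (zm * Cconj zm) - zl * zm * (Cconj zj + Cconj zk))%C
      by ring.
    replace ((zl - zj) * (zl - zk) * (Cconj zj + Cconj zk))%C
      with (zl * zl * (Cconj zj + Cconj zk) - zl * (zj + zk) * (Cconj zj + Cconj zk)
            + zk * (zj * Cconj zj) + zj * (zk * Cconj zk))%C by ring.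
    rewrite Ej, Ek, El, Em; ring. }
  assert (Hs : Cmod s <= 2 * rho)
    by (apply Rle_trans with (1 := Cmod_triangle _ _); lra).
  assert (Hd := Cmod_ge_0 d); assert (Hr : 0 <= rho) by (rewrite <- Hj; apply Cmod_ge_0).
  replace (Cmod s * (Cmod (zl - zj) * Cmod (zl - zk)))
    with (Cmod ((zl - zj) * (zl - zk) * Cconj s)%C)
    by (rewrite !Cmod_mult, Cmod_conj; ring).
  rewrite E.
  apply Rle_trans with (1 := Cmod_triangle _ _).
  apply Rle_trans with (1 := Rplus_le_compat_l _ _ _ (Cmod_triangle _ _)).
  rewrite Cmod_opp, !Cmod_mult, !Cmod_conj, Hl, Hm, Cmod_R, Rabs_right
    by (apply Rle_ge, pow2_ge_0).
  assert (Cmod d * (rho * Cmod s) <= Cmod d * (rho * (2 * rho)))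
    by (repeat apply Rmult_le_compat_l; lra).
  lra.
Qed.

(** A nonnegative inner product of [zj] and [zk] gives [|zj + zk|^2 >= 2 rho^2], so that factor can
    be divided out of the squared estimate: [16 rho^4 / (2 rho^2) = 8 rho^2]. *)
Lemma circle_pairs_close_sqr (rho : R) (zj zk zl zm : R * R) :
  0 < rho ->
  norm2 zj = rho -> norm2 zk = rho -> norm2 zl = rho -> norm2 zm = rho ->
  0 <= fst zj * fst zk + snd zj * snd zk ->
  ((fst zl - fst zj) ^ 2 + (snd zl - snd zj) ^ 2) *
  ((fst zl - fst zk) ^ 2 + (snd zl - snd zk) ^ 2) <=
  8 * rho ^ 2 * ((fst zl + fst zm - (fst zj + fst zk)) ^ 2 +
                 (snd zl + snd zm - (snd zj + snd zk)) ^ 2).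
Proof.
  intros Hr Hj Hk Hl Hm Hp.
  pose proof (circle_pairs_close rho zj zk zl zm Hj Hk Hl Hm) as H.
  assert (Hs : Cmod (zj + zk)%C ^ 2 >= 2 * rho ^ 2).
  { rewrite Cmod_sqr; simpl.
    assert (Ej := Cmod_sqr zj); assert (Ek := Cmod_sqr zk).
    change (Cmod zj) with (norm2 zj) in Ej; change (Cmod zk) with (norm2 zk) in Ek.
    rewrite Hj in Ej; rewrite Hk in Ek; nra. }
  assert (E1 := Cmod_sqr (zl - zj)%C); assert (E2 := Cmod_sqr (zl - zk)%C).
  assert (E3 := Cmod_sqr (zl + zm - (zj + zk))%C).
  cbn [fst snd Cminus Cplus Copp] in E1, E2, E3.
  unfold Rminus; rewrite <- E1, <- E2, <- E3.
  assert (H0 : 0 <= Cmod (zj + zk)%C * (Cmod (zl - zj)%C * Cmod (zl - zk)%C))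
    by (repeat apply Rmult_le_pos; apply Cmod_ge_0).
  apply (conj H0), (pow_incr _ _ 2) in H; clear H0.
  rewrite !Rpow_mult_distr in H.
  set (X := Cmod (zl - zj)%C ^ 2 * Cmod (zl - zk)%C ^ 2) in *.
  assert (HX : 0 <= X) by (apply Rmult_le_pos; apply pow2_ge_0).
  set (Y := Cmod (zl + zm - (zj + zk))%C ^ 2) in *.
  assert (0 < rho ^ 2) by (apply pow_lt; lra).
  apply Rmult_le_reg_l with (2 * rho ^ 2); [lra|].
  apply Rle_trans with (Cmod (zj + zk)%C ^ 2 * X); [apply Rmult_le_compat_r; lra|].
  apply Rle_trans with (1 := H); apply Req_le; ring.
Qed.

(** * The weight [W] and the decay of its Fourier transform *)

(** The base is [(1 + s) (2 - s)]; the square has double zeros at [-1] and [2], so two integrations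
    by parts leave no boundary terms. *)
Definition W (s : R) : R := (2 + s - s ^ 2) ^ 2.

Lemma W_ge_1 s : 0 <= s <= 1 -> 1 <= W s.
Proof. intros H; unfold W; assert (1 <= 2 + s - s ^ 2) by nra; nra. Qed.

Lemma W_nonneg s : 0 <= W s.
Proof. apply pow2_ge_0. Qed.

Definition WInt (h : R -> R) : R := RInt (fun s => W s * h s) (-1) 2.

Lemma continuous_W s : continuous W s.
Proof.
  apply (ex_derive_continuous (V := R_NormedModule)); unfold W; auto_derive; easy.
Qed.

Lemma ex_RInt_W h a b : (forall s, continuous h s) -> ex_RInt (fun s => W s * h s) a b.
Proof.
  intros H; apply (ex_RInt_continuous (V := R_CompleteNormedModule)); intros z _.
  apply (continuous_mult (K := R_AbsRing)); [apply continuous_W|apply H].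
Qed.

Lemma RInt01_le_WInt (f h : R -> R) :
  (forall s, continuous h s) -> (forall s, 0 <= h s) ->
  (forall s, 0 <= s <= 1 -> f s <= h s) -> RInt01 f <= WInt h.
Proof.
  intros Hc Hp Hf.
  assert (Hpos : forall a b, a <= b -> 0 <= RInt (fun s => W s * h s) a b).
  { intros a b Hab; apply RInt_ge_0; [easy|now apply ex_RInt_W|].
    intros s _; apply Rmult_le_pos; [apply W_nonneg|apply Hp]. }
  unfold RInt01; destruct excluded_middle_informative as [i|_].
  (* If [f] is not integrable, [RInt01 f] is [0] and the claim is [0 <= WInt h]. The lemma thus
     applies to an inner integral as a function of the outer variable without a proof of its
     integrability. *)
  2:{ apply Hpos; lra. }
  rewrite <- RInt_Reals.
  assert (Hi : ex_RInt f 0 1) by (destruct i as [pr]; now apply ex_RInt_Reals_1).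
  apply Rle_trans with (RInt (fun s => W s * h s) 0 1).
  - apply RInt_le; [lra|easy|now apply ex_RInt_W|].
    intros s Hs; apply Rle_trans with (1 := Hf s ltac:(lra)).
    rewrite <- (Rmult_1_l (h s)) at 1.
    apply Rmult_le_compat_r; [apply Hp|apply W_ge_1; lra].
  - unfold WInt.
    rewrite <- (RInt_Chasles (V := R_CompleteNormedModule) (fun s => W s * h s) (-1) 0 2)
      by now apply ex_RInt_W.
    rewrite <- (RInt_Chasles (V := R_CompleteNormedModule) (fun s => W s * h s) 0 1 2)
      by now apply ex_RInt_W.
    pose proof (Hpos (-1) 0 ltac:(lra)); pose proof (Hpos 1 2 ltac:(lra)).
    unfold plus; simpl; lra.
Qed.

(* [(1 + w^2) W cos - (W - W'') cos] is the derivative of a function that vanishes at [-1]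
   and [2], because [W] and [W'] do. *)
Lemma WInt_cos_decay (w p : R) :
  Rabs (WInt (fun s => cos (w * s + p))) <= 300 / (1 + w ^ 2).
Proof.
  (* The bracket is [W - W''] written out. *)
  set (g := fun s => (W s - (2 * (1 - 2 * s) ^ 2 - 4 * (2 + s - s ^ 2))) * cos (w * s + p)).
  assert (Hd : is_RInt (fun s => (1 + w ^ 2) * (W s * cos (w * s + p)) - g s) (-1) 2 0).
  { set (F := fun s => W s * w * sin (w * s + p)
                       + 2 * (2 + s - s ^ 2) * (1 - 2 * s) * cos (w * s + p)).
    replace 0 with (minus (F 2) (F (-1))) by (unfold minus, plus, opp, F, W; simpl; ring).
    apply (is_RInt_derive (V := R_CompleteNormedModule)); intros s _.
    - unfold F, g, W; auto_derive; [easy|ring].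
    - apply (ex_derive_continuous (V := R_NormedModule)); unfold g, W; auto_derive; easy. }
  assert (Hg : ex_RInt g (-1) 2).
  { apply (ex_RInt_continuous (V := R_CompleteNormedModule)); intros s _.
    apply (ex_derive_continuous (V := R_NormedModule)); unfold g, W; auto_derive; easy. }
  assert (Hw : 0 < 1 + w ^ 2) by (pose proof (pow2_ge_0 w); lra).
  assert (E : (1 + w ^ 2) * WInt (fun s => cos (w * s + p)) = RInt g (-1) 2).
  { assert (Hi : RInt (fun s => (1 + w ^ 2) * (W s * cos (w * s + p)) - g s + g s) (-1) 2
                 = 0 + RInt g (-1) 2)
      by exact (is_RInt_unique (V := R_CompleteNormedModule) _ _ _ _
                  (is_RInt_plus _ _ _ _ _ _ Hd (RInt_correct g _ _ Hg))).
    rewrite Rplus_0_l in Hi; rewrite <- Hi; unfold WInt.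
    assert (Hc : ex_RInt (fun s => W s * cos (w * s + p)) (-1) 2).
    { apply ex_RInt_W; intros s.
      apply (ex_derive_continuous (V := R_NormedModule)); auto_derive; easy. }
    transitivity (RInt (fun s => (1 + w ^ 2) * (W s * cos (w * s + p))) (-1) 2).
    - symmetry; exact (RInt_scal (V := R_CompleteNormedModule) _ _ _ (1 + w ^ 2) Hc).
    - apply RInt_ext; intros s _; simpl; ring. }
  replace (WInt (fun s => cos (w * s + p))) with (RInt g (-1) 2 / (1 + w ^ 2))
    by (rewrite <- E; field; lra).
  unfold Rdiv; rewrite Rabs_mult, (Rabs_right (/ _))
    by (apply Rle_ge, Rlt_le, Rinv_0_lt_compat; easy).
  apply Rmult_le_compat_r; [apply Rlt_le, Rinv_0_lt_compat; easy|].
  (* The interval has length [3], and [100] is a crude bound for [W - W''] on it. *)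
  replace 300 with ((2 - -1) * 100) by ring.
  apply abs_RInt_le_const; [lra|easy|].
  intros s Hs; unfold g; rewrite Rabs_mult, <- (Rmult_1_r 100).
  apply Rmult_le_compat; try apply Rabs_pos.
  - unfold W; assert (H1 := pow2_ge_0 (1 - 2 * s)).
    assert (H2 : 0 <= (s + 1) * (2 - s)) by (apply Rmult_le_pos; lra).
    assert (0 <= 2 + s - s ^ 2 <= 9 / 4) by lra.
    apply Rabs_le; nra.
  - apply Rabs_le; pose proof (COS_bound (w * s + p)); lra.
Qed.

(** * Weighted integrals of trigonometric sums in one and two variables *)

Lemma continuous_trig_sum {A} (l : list A) (c w p : A -> R) (s : R) :
  continuous (fun s => lsum l (fun i => c i * cos (w i * s + p i))) s.
Proof.
  induction l as [|a l IH].
  - apply continuous_const.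
  - apply (continuous_plus (V := R_NormedModule)); [|exact IH].
    apply (ex_derive_continuous (V := R_NormedModule)); auto_derive; easy.
Qed.

Lemma continuous_cos_affine (w p s : R) : continuous (fun s => cos (w * s + p)) s.
Proof. apply (ex_derive_continuous (V := R_NormedModule)); auto_derive; easy. Qed.

Lemma WInt_ext (f g : R -> R) : (forall s, f s = g s) -> WInt f = WInt g.
Proof. intros H; apply RInt_ext; intros s _; simpl; now rewrite H. Qed.

Lemma WInt_plus (f g : R -> R) :
  (forall s, continuous f s) -> (forall s, continuous g s) ->
  WInt (fun s => f s + g s) = WInt f + WInt g.
Proof.
  intros Hf Hg; unfold WInt.
  rewrite <- (RInt_plus (V := R_CompleteNormedModule) _ _ _ _
    (ex_RInt_W f _ _ Hf) (ex_RInt_W g _ _ Hg)).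
  apply RInt_ext; intros s _; unfold plus; simpl; ring.
Qed.

Lemma WInt_scal (c : R) (f : R -> R) :
  (forall s, continuous f s) -> WInt (fun s => c * f s) = c * WInt f.
Proof.
  intros Hf; unfold WInt.
  rewrite <- (RInt_scal (V := R_CompleteNormedModule) _ _ _ c (ex_RInt_W f _ _ Hf)).
  apply RInt_ext; intros s _; unfold scal, mult; simpl; unfold mult; simpl; ring.
Qed.

Lemma WInt_nonneg (f : R -> R) :
  (forall s, continuous f s) -> (forall s, 0 <= f s) -> 0 <= WInt f.
Proof.
  intros Hf Hp; apply RInt_ge_0; [lra|now apply ex_RInt_W|].
  intros s _; apply Rmult_le_pos; [apply W_nonneg|apply Hp].
Qed.

Lemma WInt_trig_sum {A} (l : list A) (c w p : A -> R) :
  WInt (fun s => lsum l (fun i => c i * cos (w i * s + p i))) =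
  lsum l (fun i => c i * WInt (fun s => cos (w i * s + p i))).
Proof.
  induction l as [|a l IH].
  - transitivity (WInt (fun s => 0 * cos (0 * s + 0))).
    + apply WInt_ext; intros s; unfold lsum; simpl; ring.
    + rewrite WInt_scal by apply continuous_cos_affine; unfold lsum; simpl; ring.
  - rewrite lsum_cons, <- IH, <- WInt_scal by apply continuous_cos_affine.
    rewrite <- WInt_plus.
    + reflexivity.
    + intros s; apply (ex_derive_continuous (V := R_NormedModule)); auto_derive; easy.
    + intros s; apply continuous_trig_sum.
Qed.

(** The addition formula, with sines written as cosines shifted by [PI / 2]. The phase [p] is
    separated from the integral, so integrating a sum in [s1] leaves a sum of cosines in [s2]. *)
Lemma WInt_cos_phase (w p : R) :
  WInt (fun s => cos (w * s + p)) =
  WInt (fun s => cos (w * s + 0)) * cos p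
  - WInt (fun s => cos (w * s + - (PI / 2))) * cos (p + - (PI / 2)).
Proof.
  transitivity (WInt (fun s => cos p * cos (w * s + 0)
    + - cos (p + - (PI / 2)) * cos (w * s + - (PI / 2)))).
  - apply WInt_ext; intros s.
    assert (E : forall x, cos (x + - (PI / 2)) = sin x)
      by (intros x; rewrite cos_plus, cos_neg, sin_neg, cos_PI2, sin_PI2; ring).
    rewrite !E, Rplus_0_r, cos_plus; ring.
  - rewrite WInt_plus, !WInt_scal; try (intros s; apply continuous_cos_affine); try ring;
    intros s; apply (ex_derive_continuous (V := R_NormedModule)); auto_derive; easy.
Qed.

(** Nonnegativity of the trigonometric majorant of [F] allows the weight [W] to be inserted in each
    variable, after which every term is integrated exactly. *)
Lemma iterated_RInt01_le {A} (l : list A) (c a b g : A -> R) (F : R -> R -> R) :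
  (forall s1 s2, 0 <= lsum l (fun i => c i * cos (a i * s1 + (b i * s2 + g i)))) ->
  (forall s1 s2, F s1 s2 <= lsum l (fun i => c i * cos (a i * s1 + (b i * s2 + g i)))) ->
  RInt01 (fun s2 => RInt01 (fun s1 => F s1 s2)) <=
  lsum l (fun i => Rabs (c i) * (180000 / ((1 + a i ^ 2) * (1 + b i ^ 2)))).
Proof.
  intros Hp HF.
  set (T := fun s1 s2 => lsum l (fun i => c i * cos (a i * s1 + (b i * s2 + g i)))) in *.
  set (E := fun w p => WInt (fun s => cos (w * s + p))).
  set (H2 := fun s2 => lsum l (fun i => c i * E (a i) 0 * cos (b i * s2 + g i))
    + lsum l (fun i => - (c i * E (a i) (- (PI / 2))) * cos (b i * s2 + (g i + - (PI / 2))))).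
  assert (HH : forall s2, WInt (fun s1 => T s1 s2) = H2 s2).
  { intros s2; unfold T, H2; rewrite WInt_trig_sum, <- lsum_plus.
    apply lsum_ext; intros i _; unfold E; rewrite WInt_cos_phase, Rplus_assoc; ring. }
  assert (Hc : forall s, continuous H2 s)
    by (intros s; apply (continuous_plus (V := R_NormedModule)); apply continuous_trig_sum).
  apply Rle_trans with (WInt H2).
  - apply RInt01_le_WInt; [exact Hc| |].
    + intros s; rewrite <- HH; apply WInt_nonneg;
        [intros s1; apply continuous_trig_sum|intros s1; apply Hp].
    + intros s _; rewrite <- HH; apply RInt01_le_WInt;
        [intros s1; apply continuous_trig_sum|intros s1; apply Hp|intros s1 _; apply HF].
  - unfold H2; rewrite WInt_plus by (intros s; apply continuous_trig_sum).
    rewrite !WInt_trig_sum, <- lsum_plus; apply lsum_le; intros i _.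
    fold (E (b i) (g i)) (E (b i) (g i + - (PI / 2))).
    assert (Hx : forall x : R, 0 < 1 + x ^ 2) by (intros x; pose proof (pow2_ge_0 x); lra).
    (* [WInt_cos_phase] yields two products, each at most [300^2] times the decay, and
       [2 * 300^2 = 180000]. *)
    replace (180000 / ((1 + a i ^ 2) * (1 + b i ^ 2)))
      with (2 * (300 / (1 + a i ^ 2) * (300 / (1 + b i ^ 2)))).
    2:{ field; split; apply Rgt_not_eq, Hx. }
    assert (HE : forall p q, Rabs (E (a i) p * E (b i) q)
                             <= 300 / (1 + a i ^ 2) * (300 / (1 + b i ^ 2))).
    { intros p q; rewrite Rabs_mult; apply Rmult_le_compat; try apply Rabs_pos;
        apply WInt_cos_decay. }
    set (e := 300 / (1 + a i ^ 2) * (300 / (1 + b i ^ 2))) in *.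
    set (x1 := E (a i) 0 * E (b i) (g i)).
    set (x2 := E (a i) (- (PI / 2)) * E (b i) (g i + - (PI / 2))).
    replace (_ + _) with (c i * (x1 - x2)) by (unfold x1, x2; ring).
    apply Rle_trans with (1 := Rle_abs _); rewrite Rabs_mult.
    apply Rmult_le_compat_l; [apply Rabs_pos|].
    apply Rle_trans with (1 := Rabs_triang _ _); rewrite Rabs_Ropp.
    assert (H1 := HE 0 (g i)); assert (H3 := HE (- (PI / 2)) (g i + - (PI / 2))).
    fold x1 in H1; fold x2 in H3; lra.
Qed.

(** * Polar form of the coefficients and expansion of the fourth power *)

Lemma polar_form (u v : R) : exists r p, 0 <= r /\ u = r * cos p /\ v = r * sin p.
Proof.
  assert (Hr : 0 <= u ^ 2 + v ^ 2)
    by (pose proof (pow2_ge_0 u); pose proof (pow2_ge_0 v); lra).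
  set (r := sqrt (u ^ 2 + v ^ 2)).
  assert (Er : r * r = u ^ 2 + v ^ 2) by now apply sqrt_sqrt.
  assert (H0 : 0 <= r) by apply sqrt_pos.
  destruct (Req_dec r 0) as [E|E].
  { exists 0, 0; assert (u = 0) by nra; assert (v = 0) by nra; lra. }
  assert (Hpos : 0 < r) by lra.
  set (x := u / r).
  assert (Eu : u = r * x) by (unfold x; field; lra).
  assert (Hx2 : x * x <= 1).
  { apply Rmult_le_reg_l with (r * r); [nra|].
    replace (r * r * (x * x)) with (u ^ 2) by (rewrite Eu; ring).
    pose proof (pow2_ge_0 v); lra. }
  assert (Hx : -1 <= x <= 1) by (split; nra).
  assert (Hs : sqrt (1 - x²) = Rabs v / r).
  { replace (1 - x²) with ((Rabs v / r)²).
    - apply sqrt_Rsqr; apply Rmult_le_pos; [apply Rabs_pos|].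
      now apply Rlt_le, Rinv_0_lt_compat.
    - replace ((Rabs v / r)²) with ((Rabs v)² / (r * r)) by (unfold Rsqr; field; lra).
      rewrite <- Rsqr_abs; unfold Rsqr.
      replace (v * v) with (r * r - u * u) by (rewrite Er; ring).
      rewrite Eu; field; lra. }
  destruct (Rle_dec 0 v) as [Hv|Hv].
  - exists r, (acos x); rewrite cos_acos, sin_acos, Hs, Rabs_right by lra.
    split; [|split]; [easy|easy|field; lra].
  - exists r, (- acos x); rewrite cos_neg, sin_neg, cos_acos, sin_acos, Hs, Rabs_left by lra.
    split; [|split]; [easy|easy|field; lra].
Qed.

Lemma trig_sum_sqr_norm {A} (l : list A) (r th : A -> R) :
  lsum l (fun k => r k * cos (th k)) ^ 2 + lsum l (fun k => r k * sin (th k)) ^ 2 =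
  lsum (list_prod l l) (fun p => r (fst p) * r (snd p) * cos (th (fst p) - th (snd p))).
Proof.
  simpl; rewrite !Rmult_1_r, !lsum_mul, <- lsum_plus.
  apply lsum_ext; intros [j k] _; simpl; rewrite cos_minus; ring.
Qed.

(** [|f|^4 = |f^2|^2], and [f^2] is again a trigonometric sum, indexed by pairs; [C * C - S * S] and
    [2 C S] are its real and imaginary parts. *)
Lemma trig_sum_abs4 {A} (l : list A) (r th : A -> R) :
  (lsum l (fun k => r k * cos (th k)) ^ 2 + lsum l (fun k => r k * sin (th k)) ^ 2) ^ 2 =
  lsum (list_prod (list_prod l l) (list_prod l l)) (fun x =>
    r (fst (fst x)) * r (snd (fst x)) * (r (fst (snd x)) * r (snd (snd x))) *
    cos (th (fst (fst x)) + th (snd (fst x)) - (th (fst (snd x)) + th (snd (snd x))))).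
Proof.
  rewrite <- (trig_sum_sqr_norm (list_prod l l) (fun p => r (fst p) * r (snd p))
    (fun p => th (fst p) + th (snd p))).
  set (C := lsum l (fun k => r k * cos (th k))).
  set (S := lsum l (fun k => r k * sin (th k))).
  replace (lsum (list_prod l l) (fun k => r (fst k) * r (snd k) * cos (th (fst k) + th (snd k))))
    with (C * C + -1 * (S * S)).
  2:{ unfold C, S; rewrite !lsum_mul, <- lsum_scal, <- lsum_plus.
      apply lsum_ext; intros [j k] _; simpl; rewrite cos_plus; ring. }
  replace (lsum (list_prod l l) (fun k => r (fst k) * r (snd k) * sin (th (fst k) + th (snd k))))
    with (C * S + S * C).
  2:{ unfold C, S; rewrite !lsum_mul, <- lsum_plus.
      apply lsum_ext; intros [j k] _; simpl; rewrite sin_plus; ring. }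
  ring.
Qed.

(** Cauchy-Schwarz for four terms, used on the coordinates and then on the squared moduli:
    [4^2 * 4 = 64]. *)
Lemma four_terms_abs4 (x1 x2 x3 x4 y1 y2 y3 y4 : R) :
  ((x1 + x2 + (x3 + x4)) ^ 2 + (y1 + y2 + (y3 + y4)) ^ 2) ^ 2 <=
  64 * ((x1 ^ 2 + y1 ^ 2) ^ 2 + (x2 ^ 2 + y2 ^ 2) ^ 2 +
        ((x3 ^ 2 + y3 ^ 2) ^ 2 + (x4 ^ 2 + y4 ^ 2) ^ 2)).
Proof.
  assert (H : forall a b c d, (a + b + (c + d)) ^ 2 <= 4 * (a ^ 2 + b ^ 2 + (c ^ 2 + d ^ 2))).
  { intros a b c d; pose proof (pow2_ge_0 (a - b)); pose proof (pow2_ge_0 (a - c));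
    pose proof (pow2_ge_0 (a - d)); pose proof (pow2_ge_0 (b - c));
    pose proof (pow2_ge_0 (b - d)); pose proof (pow2_ge_0 (c - d)); lra. }
  apply Rle_trans with ((4 * ((x1 ^ 2 + y1 ^ 2) + (x2 ^ 2 + y2 ^ 2)
    + ((x3 ^ 2 + y3 ^ 2) + (x4 ^ 2 + y4 ^ 2)))) ^ 2).
  - apply pow_incr; split.
    + apply Rplus_le_le_0_compat; apply pow2_ge_0.
    + pose proof (H x1 x2 x3 x4); pose proof (H y1 y2 y3 y4); lra.
  - rewrite Rpow_mult_distr.
    pose proof (H (x1 ^ 2 + y1 ^ 2) (x2 ^ 2 + y2 ^ 2) (x3 ^ 2 + y3 ^ 2) (x4 ^ 2 + y4 ^ 2)); lra.
Qed.

(** * Geometry of a quarter circle and splitting of the kernel *)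

Definition in_quadrant (e1 e2 : R) (z : R * R) : Prop := 0 <= e1 * fst z /\ 0 <= e2 * snd z.

(** With signs [e1], [e2] equal to [1] or [-1], this is [|x| - |y|] on the chosen quadrant. It is
    monotone along the quarter circle and replaces arc length. *)
Definition arc_coord (e1 e2 : R) (z : R * R) : R := e1 * fst z - e2 * snd z.

(* On a quarter circle one coordinate increases when the other decreases, so the two
   increments add up without cancellation in [arc_coord]. *)
Lemma arc_coord_bilipschitz (rho e1 e2 : R) (z z' : R * R) :
  e1 ^ 2 = 1 -> e2 ^ 2 = 1 -> norm2 z = rho -> norm2 z' = rho ->
  in_quadrant e1 e2 z -> in_quadrant e1 e2 z' ->
  (fst z - fst z') ^ 2 + (snd z - snd z') ^ 2 <=
    (arc_coord e1 e2 z - arc_coord e1 e2 z') ^ 2 <=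
  2 * ((fst z - fst z') ^ 2 + (snd z - snd z') ^ 2).
Proof.
  destruct z as [x y], z' as [x' y']; unfold in_quadrant, arc_coord; simpl fst; simpl snd.
  intros H1 H2 Hz Hz' [Hx Hy] [Hx' Hy'].
  assert (E := Cmod_sqr (x, y)); assert (E' := Cmod_sqr (x', y')); cbn [fst snd] in E, E'.
  change (Cmod (x, y)) with (norm2 (x, y)) in E; change (Cmod (x', y')) with (norm2 (x', y')) in E'.
  rewrite Hz in E; rewrite Hz' in E'; clear Hz Hz'.
  replace ((x - x') ^ 2 + (y - y') ^ 2)
    with (e1 ^ 2 * (x - x') ^ 2 + e2 ^ 2 * (y - y') ^ 2) by (rewrite H1, H2; ring).
  assert (EE : e1 ^ 2 * x ^ 2 + e2 ^ 2 * y ^ 2 = e1 ^ 2 * x' ^ 2 + e2 ^ 2 * y' ^ 2)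
    by (rewrite H1, H2; lra).
  clear H1 H2 E E'.
  set (X := e1 * x) in *; set (X' := e1 * x') in *; set (Y := e2 * y) in *; set (Y' := e2 * y') in *.
  assert (F : (X - X') * (X + X') = - ((Y - Y') * (Y + Y'))) by (unfold X, X', Y, Y'; lra).
  replace (e1 ^ 2 * (x - x') ^ 2 + e2 ^ 2 * (y - y') ^ 2)
    with ((X - X') ^ 2 + (Y - Y') ^ 2) by (unfold X, X', Y, Y'; ring).
  assert (N : (X - X') * (Y - Y') <= 0).
  (* If the increments had the same strict sign, multiplying [F] by [Y - Y'] would force
     [X + X' <= 0], hence [X = X' = 0], a contradiction. *)
  { destruct (Rle_dec ((X - X') * (Y - Y')) 0) as [|N]; [easy|exfalso].
    assert (FF : (X - X') * (Y - Y') * (X + X') = - ((Y - Y') ^ 2 * (Y + Y')))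
      by (transitivity ((X - X') * (X + X') * (Y - Y')); [ring|rewrite F; ring]).
    assert (0 <= (Y - Y') ^ 2 * (Y + Y')) by (apply Rmult_le_pos; [apply pow2_ge_0|lra]).
    assert (X + X' <= 0) by nra.
    assert (X - X' = 0) by lra; nra. }
  split; [nra|pose proof (pow2_ge_0 ((X - X') + (Y - Y'))); lra].
Qed.

(** Since [32 <= 6^2], the smaller of [y1], [y2] is at most [6 e] with [e = sqrt D], so each factor
    on the right is at least [1 / (1 + 6 e)]. Finally [(1 + 6 e)^2 <= 2 (1 + 36 e^2) <= 72 (1 +
    D)]. *)
Lemma kernel_splitting (D y1 y2 y1' y2' : R) :
  0 <= D -> 0 <= y1 -> 0 <= y2 -> 0 <= y1' -> 0 <= y2' ->
  y1 * y2 <= 32 * D -> y1' * y2' <= 32 * D ->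
  / (1 + D) <= 72 * ((/ (1 + y1) + / (1 + y2)) * (/ (1 + y1') + / (1 + y2'))).
Proof.
  intros HD Hy1 Hy2 Hy1' Hy2' H H'.
  set (e := sqrt D).
  assert (Ee : e * e = D) by now apply sqrt_sqrt.
  assert (He : 0 <= e) by apply sqrt_pos.
  assert (K : forall a b, 0 <= a -> 0 <= b -> a * b <= 32 * D ->
    / (1 + 6 * e) <= / (1 + a) + / (1 + b)).
  { intros a b Ha Hb Hab.
    assert (0 < / (1 + a)) by (apply Rinv_0_lt_compat; lra).
    assert (0 < / (1 + b)) by (apply Rinv_0_lt_compat; lra).
    destruct (Rle_dec a (6 * e)).
    - assert (/ (1 + 6 * e) <= / (1 + a)) by (apply Rinv_le_contravar; lra); lra.
    - assert (b <= 6 * e) by nra.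
      assert (/ (1 + 6 * e) <= / (1 + b)) by (apply Rinv_le_contravar; lra); lra. }
  apply Rle_trans with (72 * (/ (1 + 6 * e) * / (1 + 6 * e))).
  - rewrite <- Rinv_mult, <- Ee.
    replace 72 with (/ / 72) by field.
    rewrite <- Rinv_mult; apply Rinv_le_contravar; nra.
  - apply Rmult_le_compat_l; [lra|].
    assert (0 < / (1 + 6 * e)) by (apply Rinv_0_lt_compat; lra).
    apply Rmult_le_compat; try lra; now apply K.
Qed.

Lemma fold_max_ge (l : list nat) (f : nat -> nat) k :
  In k l -> (f k <= fold_right Nat.max 0 (map f l))%nat.
Proof.
  induction l as [|a l IH]; [easy|]; intros [<-|Hk]; simpl; [lia|].
  specialize (IH Hk); lia.
Qed.

(** * The quadratic form for frequencies on one quarter circle *)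

Section QuarterCircle.

Variables (n : nat) (xi : nat -> R * R) (rho e1 e2 : R) (L : list nat).
Hypothesis rho_pos : 0 < rho.
Hypothesis e1_sqr : e1 ^ 2 = 1.
Hypothesis e2_sqr : e2 ^ 2 = 1.
Hypothesis L_nodup : NoDup L.
Hypothesis L_incl : incl L (seq 0 n).
Hypothesis L_norm : forall k, In k L -> norm2 (xi k) = rho.
Hypothesis L_quadrant : forall k, In k L -> in_quadrant e1 e2 (xi k).

Let M := INR (maxcap n xi rho).
Let tau k := arc_coord e1 e2 (xi k).

(** If the window contains some [tau j], then by [arc_coord_bilipschitz] all its points lie within
    [sqrt rho] of [xi j], and [cap_count] at [j] counts them. *)
Lemma arc_coord_window (a : R) :
  lsum L (fun k => if itv a (a + sqrt rho) (tau k) then 1 else 0) <= M.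
Proof.
  rewrite lsum_indicator; unfold M; apply le_INR.
  destruct (filter _ L) as [|j l] eqn:E; [simpl; lia|].
  rewrite <- E.
  assert (Hin : forall k, In k (j :: l) -> In k L /\ a <= tau k <= a + sqrt rho).
  { intros k Hk; rewrite <- E in Hk; apply filter_In in Hk; rewrite itvP in Hk; exact Hk. }
  destruct (Hin j (or_introl eq_refl)) as [Hj Htj].
  apply Nat.le_trans with (cap_count n xi (sqrt rho) j).
  2:{ apply fold_max_ge, L_incl, Hj. }
  apply NoDup_incl_length; [now apply NoDup_filter|].
  rewrite E; intros k Hk; destruct (Hin k Hk) as [HkL Htk].
  apply filter_In; split; [now apply L_incl|].
  destruct (Rle_dec _ _) as [|H]; [easy|exfalso; apply H].
  destruct (arc_coord_bilipschitz rho e1 e2 (xi k) (xi j)) as [H1 _]; auto.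
  unfold dist2; apply Rle_trans with (1 := sqrt_le_1_alt _ _ H1).
  fold (tau k) (tau j); rewrite <- Rsqr_pow2, sqrt_Rsqr_abs; apply Rabs_le; lra.
Qed.

Let phi j k := / (1 + ((tau k - tau j) / sqrt rho) ^ 2).

Lemma lsum_phi (j : nat) : lsum L (phi j) <= 6 * M.
Proof.
  apply (lsum_two_sided L tau (tau j) (sqrt rho) M).
  - now apply sqrt_lt_R0.
  - apply pos_INR.
  - exact arc_coord_window.
Qed.

Let gap j k l m :=
  (fst (xi l) + fst (xi m) - (fst (xi j) + fst (xi k))) ^ 2 +
  (snd (xi l) + snd (xi m) - (snd (xi j) + snd (xi k))) ^ 2.

(** The constant is [8] from [circle_pairs_close_sqr] times [2] from [arc_coord_bilipschitz] for
    each difference; the scale [sqrt rho] absorbs [rho^2]. Points of one quadrant have nonnegative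
    inner product, as [Hp] records. *)
Lemma arc_coord_gap (j k l m : nat) :
  In j L -> In k L -> In l L -> In m L ->
  ((tau l - tau j) / sqrt rho) ^ 2 * ((tau l - tau k) / sqrt rho) ^ 2 <= 32 * gap j k l m.
Proof.
  intros Hj Hk Hl Hm.
  assert (Hp : 0 <= fst (xi j) * fst (xi k) + snd (xi j) * snd (xi k)).
  { destruct (L_quadrant j Hj) as [Hx Hy], (L_quadrant k Hk) as [Hx' Hy'].
    replace (fst (xi j) * fst (xi k)) with ((e1 * fst (xi j)) * (e1 * fst (xi k)))
      by (transitivity (e1 ^ 2 * (fst (xi j) * fst (xi k))); [ring|rewrite e1_sqr; ring]).
    replace (snd (xi j) * snd (xi k)) with ((e2 * snd (xi j)) * (e2 * snd (xi k)))
      by (transitivity (e2 ^ 2 * (snd (xi j) * snd (xi k))); [ring|rewrite e2_sqr; ring]).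
    apply Rplus_le_le_0_compat; now apply Rmult_le_pos. }
  pose proof (circle_pairs_close_sqr rho (xi j) (xi k) (xi l) (xi m) rho_pos
    (L_norm j Hj) (L_norm k Hk) (L_norm l Hl) (L_norm m Hm) Hp) as H.
  fold (gap j k l m) in H.
  destruct (arc_coord_bilipschitz rho e1 e2 (xi l) (xi j)) as [_ H1]; auto.
  destruct (arc_coord_bilipschitz rho e1 e2 (xi l) (xi k)) as [_ H2]; auto.
  fold (tau l) (tau j) in H1; fold (tau l) (tau k) in H2.
  assert (Hs := sqrt_lt_R0 rho rho_pos).
  assert (Es : sqrt rho ^ 2 = rho) by (apply pow2_sqrt; lra).
  replace (((tau l - tau j) / sqrt rho) ^ 2 * ((tau l - tau k) / sqrt rho) ^ 2)
    with ((tau l - tau j) ^ 2 * (tau l - tau k) ^ 2 / (sqrt rho ^ 2) ^ 2) by (field; lra).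
  rewrite Es; apply Rle_div_l; [apply pow_lt; lra|].
  apply Rle_trans with (1 := Rmult_le_compat _ _ _ _ (pow2_ge_0 _) (pow2_ge_0 _) H1 H2).
  lra.
Qed.

Lemma inv_gap_le (j k l m : nat) :
  In j L -> In k L -> In l L -> In m L ->
  / (1 + gap j k l m) <= 72 * ((phi j l + phi k l) * (phi j m + phi k m)).
Proof.
  intros Hj Hk Hl Hm; apply kernel_splitting; try apply pow2_ge_0.
  - apply Rplus_le_le_0_compat; apply pow2_ge_0.
  - now apply arc_coord_gap.
  - replace (gap j k l m) with (gap j k m l) by (unfold gap; ring).
    now apply arc_coord_gap.
Qed.

(** After [inv_gap_le] the sum over [(l, m)] factors into the square of a single sum of size at most
    [12 * M], and [72 * 12^2 = 10368]. *)
Lemma lsum_inv_gap_le (p : nat * nat) :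
  In p (list_prod L L) ->
  lsum (list_prod L L) (fun q => / (1 + gap (fst p) (snd p) (fst q) (snd q)))
  <= 10368 * M ^ 2.
Proof.
  destruct p as [j k]; intros Hp; apply in_prod_iff in Hp; destruct Hp as [Hj Hk]; simpl fst; simpl snd.
  assert (Hphi : forall i k, 0 <= phi i k).
  { intros; apply Rlt_le, Rinv_0_lt_compat.
    pose proof (pow2_ge_0 ((tau k0 - tau i) / sqrt rho)); lra. }
  set (S := lsum L (fun l => phi j l + phi k l)).
  assert (HS : 0 <= S <= 12 * M).
  { split.
    - apply lsum_nonneg; intros l _; pose proof (Hphi j l); pose proof (Hphi k l); lra.
    - unfold S; rewrite lsum_plus; pose proof (lsum_phi j); pose proof (lsum_phi k).
      unfold phi in *; lra. }
  apply Rle_trans with (72 * (S * S)).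
  - unfold S; rewrite lsum_mul, <- lsum_scal; apply lsum_le.
    intros [l m] H; apply in_prod_iff in H; destruct H as [Hl Hm]; now apply inv_gap_le.
  - assert (S * S <= (12 * M) * (12 * M)) by (apply Rmult_le_compat; lra); lra.
Qed.

(** Here [a] and [b] stand for the frequency coordinates along the sides of the square. As
    [(1 + A^2) (1 + B^2) >= 1 + A^2 + B^2], the kernel is at most [1 / (1 + gap)], and Schur's test
    on pairs applies. *)
Lemma quarter_circle_energy (r a b : nat -> R) :
  (forall k, 0 <= r k) ->
  (forall j k l m, gap j k l m <=
     (a l + a m - (a j + a k)) ^ 2 + (b l + b m - (b j + b k)) ^ 2) ->
  lsum (list_prod (list_prod L L) (list_prod L L)) (fun x =>
    r (fst (fst x)) * r (snd (fst x)) * (r (fst (snd x)) * r (snd (snd x))) *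
    / ((1 + (a (fst (fst x)) + a (snd (fst x)) - (a (fst (snd x)) + a (snd (snd x)))) ^ 2) *
       (1 + (b (fst (fst x)) + b (snd (fst x)) - (b (fst (snd x)) + b (snd (snd x)))) ^ 2)))
  <= 10368 * M ^ 2 * lsum L (fun k => r k ^ 2) ^ 2.
Proof.
  intros Hr Hgap.
  set (G := fun p q : nat * nat => gap (fst p) (snd p) (fst q) (snd q)).
  assert (HG : forall p q, 0 <= G p q)
    by (intros; apply Rplus_le_le_0_compat; apply pow2_ge_0).
  replace (lsum L (fun k => r k ^ 2) ^ 2)
    with (lsum (list_prod L L) (fun p => (r (fst p) * r (snd p)) ^ 2)).
  2:{ simpl pow at 2; rewrite Rmult_1_r, lsum_mul; apply lsum_ext; intros; ring. }
  apply Rle_trans with (2 := schur_test (list_prod L L) (fun p => r (fst p) * r (snd p))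
    (fun p q => / (1 + G p q)) (10368 * M ^ 2)
    ltac:(intros p q _ _; apply Rlt_le, Rinv_0_lt_compat; specialize (HG p q); lra)
    ltac:(intros p q; unfold G, gap; do 2 f_equal; ring) lsum_inv_gap_le).
  rewrite lsum_prod; apply lsum_le; intros p _; apply lsum_le; intros q _; simpl fst; simpl snd.
  apply Rmult_le_compat_l; [repeat apply Rmult_le_pos; apply Hr|].
  specialize (HG p q); specialize (Hgap (fst p) (snd p) (fst q) (snd q)).
  fold (G p q) in Hgap; apply Rinv_le_contravar; [lra|].
  (* The kernel contains the differences from [q] to [p], [gap] those from [p] to [q]; their squares
     agree. *)
  set (A := a (fst p) + _ - _).
  replace (a (fst q) + a (snd q) - (a (fst p) + a (snd p))) with (- A) in Hgap by (unfold A; ring).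
  set (B := b (fst p) + _ - _).
  replace (b (fst q) + b (snd q) - (b (fst p) + b (snd p))) with (- B) in Hgap by (unfold B; ring).
  assert (0 <= A ^ 2 * B ^ 2) by (apply Rmult_le_pos; apply pow2_ge_0); lra.
Qed.

End QuarterCircle.

(** * Assembling the four quarter circles *)

Definition nonnegb (x : R) : bool := if Rle_dec 0 x then true else false.

Lemma square_integral_abs4_le (Rad : R) (n : nat) (xi : nat -> R * R) (u v : nat -> R)
  (c1 c2 t : R) :
  0 < Rad -> (forall k, (k < n)%nat -> norm2 (xi k) = Rad) ->
  square_integral (expsum_abs4 n xi u v) c1 c2 t <=
  1000 ^ 4 * INR (maxcap n xi Rad) ^ 2 * rsum n (fun k => u k ^ 2 + v k ^ 2) ^ 2.
Proof.
  intros HR Hxi.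
  (* The phases of the coefficients are moved into the exponentials, leaving nonnegative
     coefficients [r]. *)
  destruct (choice (fun k (z : R * R) =>
    0 <= fst z /\ u k = fst z * cos (snd z) /\ v k = fst z * sin (snd z))) as [z Hz].
  { intros k; destruct (polar_form (u k) (v k)) as (r & p & H); now exists (r, p). }
  set (r := fun k => fst (z k)); set (p := fun k => snd (z k)).
  assert (Hr : forall k, 0 <= r k) by (intros k; apply Hz).
  assert (Hu : forall k, u k = r k * cos (p k)) by (intros k; apply Hz).
  assert (Hv : forall k, v k = r k * sin (p k)) by (intros k; apply Hz).
  clearbody r p; clear z Hz.
  (* [a] and [b] are the coordinates of [2 * PI * xi k] in the frame of the square; [g] collects the
     phase at the corner and that of the coefficient. *)
  set (a := fun k => 2 * PI * (fst (xi k) * cos t + snd (xi k) * sin t)).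
  set (b := fun k => 2 * PI * (- fst (xi k) * sin t + snd (xi k) * cos t)).
  set (g := fun k => 2 * PI * (fst (xi k) * c1 + snd (xi k) * c2) + p k).
  set (th := fun s1 s2 k => a k * s1 + (b k * s2 + g k)).
  set (F := fun l s1 s2 => (lsum l (fun k => r k * cos (th s1 s2 k)) ^ 2
                            + lsum l (fun k => r k * sin (th s1 s2 k)) ^ 2) ^ 2).
  assert (HF : forall s1 s2, expsum_abs4 n xi u v
    (c1 + s1 * cos t - s2 * sin t) (c2 + s1 * sin t + s2 * cos t) = F (seq 0 n) s1 s2).
  { intros s1 s2; unfold expsum_abs4, expsum_re, expsum_im, F.
    change (rsum n) with (lsum (seq 0 n)).
    set (ph := fun k => phase xi k (c1 + s1 * cos t - s2 * sin t) (c2 + s1 * sin t + s2 * cos t)).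
    assert (E : forall k, th s1 s2 k = ph k + p k)
      by (intros k; unfold th, a, b, g, ph, phase; ring).
    f_equal; f_equal; f_equal; apply lsum_ext; intros k _; rewrite E, Hu, Hv; fold (ph k);
      [rewrite cos_plus|rewrite sin_plus]; ring. }
  set (px := fun k => nonnegb (fst (xi k))); set (py := fun k => nonnegb (snd (xi k))).
  set (Lx := filter px (seq 0 n)); set (Lx' := filter (fun k => negb (px k)) (seq 0 n)).
  set (L1 := filter py Lx); set (L2 := filter (fun k => negb (py k)) Lx).
  set (L3 := filter py Lx'); set (L4 := filter (fun k => negb (py k)) Lx').
  assert (Hsplit : forall f, lsum (seq 0 n) f = lsum L1 f + lsum L2 f + (lsum L3 f + lsum L4 f)).
  { intros f; rewrite (lsum_filter px); fold Lx Lx'.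
    rewrite (lsum_filter py Lx), (lsum_filter py Lx'); reflexivity. }
  set (quad := fun l : list nat => list_prod (list_prod l l) (list_prod l l)).
  (* Concatenating the four lists of quadruples turns the majorant of [four_terms_abs4] into one
     trigonometric sum. *)
  set (X := (quad L1 ++ quad L2) ++ (quad L3 ++ quad L4)).
  set (q := fun (f : nat -> R) (x : (nat * nat) * (nat * nat)) =>
    f (fst (fst x)) + f (snd (fst x)) - (f (fst (snd x)) + f (snd (snd x)))).
  set (rr := fun x : (nat * nat) * (nat * nat) =>
    r (fst (fst x)) * r (snd (fst x)) * (r (fst (snd x)) * r (snd (snd x)))).
  assert (HT : forall s1 s2,
    lsum X (fun x => 64 * rr x * cos (q a x * s1 + (q b x * s2 + q g x))) =
    64 * (F L1 s1 s2 + F L2 s1 s2 + (F L3 s1 s2 + F L4 s1 s2))).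
  { intros s1 s2; unfold F; rewrite !trig_sum_abs4; unfold X; rewrite <- !lsum_app, <- lsum_scal.
    apply lsum_ext; intros x _; rewrite Rmult_assoc; unfold rr; do 3 f_equal.
    unfold q, th; ring. }
  assert (HF0 : forall l s1 s2, 0 <= F l s1 s2) by (intros; apply pow2_ge_0).
  unfold square_integral.
  eapply Rle_trans.
  { apply (iterated_RInt01_le X (fun x => 64 * rr x) (q a) (q b) (q g)).
    - intros s1 s2; rewrite HT; pose proof (HF0 L1 s1 s2); pose proof (HF0 L2 s1 s2);
      pose proof (HF0 L3 s1 s2); pose proof (HF0 L4 s1 s2); lra.
    - intros s1 s2; rewrite HT, HF; unfold F at 1; rewrite !Hsplit; apply four_terms_abs4. }
  set (S := rsum n (fun k => u k ^ 2 + v k ^ 2)).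
  assert (HS : S = lsum (seq 0 n) (fun k => r k ^ 2)).
  { unfold S; change (rsum n) with (lsum (seq 0 n)); apply lsum_ext; intros k _.
    rewrite Hu, Hv; transitivity (r k ^ 2 * ((sin (p k))² + (cos (p k))²));
      [unfold Rsqr; ring|rewrite sin2_cos2; ring]. }
  set (M := INR (maxcap n xi Rad)).
  assert (Hpart : forall e1 e2 l, e1 ^ 2 = 1 -> e2 ^ 2 = 1 ->
    NoDup l -> (forall k, In k l -> In k (seq 0 n) /\ in_quadrant e1 e2 (xi k)) ->
    lsum l (fun k => r k ^ 2) <= S ->
    lsum (quad l) (fun x => Rabs (64 * rr x) * (180000 / ((1 + q a x ^ 2) * (1 + q b x ^ 2))))
    <= 64 * 180000 * (10368 * M ^ 2 * S ^ 2)).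
  { intros e1 e2 l He1 He2 Hnd Hl HlS.
    assert (Hle := quarter_circle_energy n xi Rad e1 e2 l HR He1 He2 Hnd
      (fun k Hk => proj1 (Hl k Hk))
      (fun k Hk => Hxi k (proj2 (proj1 (in_seq n 0 k) (proj1 (Hl k Hk)))))
      (fun k Hk => proj2 (Hl k Hk)) r a b Hr).
    apply Rle_trans with (64 * 180000 * (10368 * M ^ 2 * lsum l (fun k => r k ^ 2) ^ 2)).
    - eapply Rle_trans; [|apply Rmult_le_compat_l; [lra|apply Hle]].
      + rewrite <- lsum_scal; apply Req_le, lsum_ext; intros x _.
        rewrite Rabs_right.
        * unfold rr, q, Rdiv; ring.
        * apply Rle_ge; repeat apply Rmult_le_pos; try apply Hr; lra.
      + intros j k l0 m.
        set (dx := fst (xi l0) + _ - _); set (dy := snd (xi l0) + _ - _).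
        replace (a l0 + a m - (a j + a k)) with (2 * PI * (dx * cos t + dy * sin t))
          by (unfold a, dx, dy; ring).
        replace (b l0 + b m - (b j + b k)) with (2 * PI * (- dx * sin t + dy * cos t))
          by (unfold b, dx, dy; ring).
        (* Rotation by [t] preserves length, and [2 * PI >= 1]. *)
        apply Rle_trans with ((2 * PI) ^ 2 * ((dx ^ 2 + dy ^ 2) * ((sin t)² + (cos t)²)));
          [|apply Req_le; unfold Rsqr; ring].
        rewrite sin2_cos2, Rmult_1_r.
        rewrite <- (Rmult_1_l (dx ^ 2 + dy ^ 2)) at 1.
        apply Rmult_le_compat_r; [apply Rplus_le_le_0_compat; apply pow2_ge_0|].
        pose proof PI2_1; nra.
    - apply Rmult_le_compat_l; [lra|]; apply Rmult_le_compat_l.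
      + pose proof (pow2_ge_0 M); lra.
      + apply pow_incr; split; [|easy]; apply lsum_nonneg; intros; apply pow2_ge_0. }
  assert (HlS : forall f g, lsum (filter f (filter g (seq 0 n))) (fun k => r k ^ 2) <= S).
  { intros f h; rewrite HS.
    apply Rle_trans with (lsum (filter h (seq 0 n)) (fun k => r k ^ 2));
      apply lsum_filter_le; intros; apply pow2_ge_0. }
  assert (Hnd : forall f g, NoDup (filter f (filter g (seq 0 n))))
    by (intros; do 2 apply NoDup_filter; apply seq_NoDup).
  assert (Hquad : forall f h e1 e2 k, In k (filter f (filter h (seq 0 n))) ->
    (h k = true -> 0 <= e1 * fst (xi k)) -> (f k = true -> 0 <= e2 * snd (xi k)) ->
    In k (seq 0 n) /\ in_quadrant e1 e2 (xi k)).
  { intros f h e1 e2 k Hk H1 H2; apply filter_In in Hk; destruct Hk as [Hk Hf].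
    apply filter_In in Hk; destruct Hk as [Hk Hh]; split; [easy|split; auto]. }
  assert (Hpos : forall x, nonnegb x = true -> 0 <= 1 * x)
    by (unfold nonnegb; intros x; destruct Rle_dec; intros; [lra|easy]).
  assert (Hneg : forall x, negb (nonnegb x) = true -> 0 <= -1 * x)
    by (unfold nonnegb; intros x; destruct Rle_dec; intros; [easy|lra]).
  assert (B1 := Hpart 1 1 L1 ltac:(ring) ltac:(ring) (Hnd _ _)
    (fun k Hk => Hquad _ _ 1 1 k Hk (Hpos _) (Hpos _)) (HlS _ _)).
  assert (B2 := Hpart 1 (-1) L2 ltac:(ring) ltac:(ring) (Hnd _ _)
    (fun k Hk => Hquad _ _ 1 (-1) k Hk (Hpos _) (Hneg _)) (HlS _ _)).
  assert (B3 := Hpart (-1) 1 L3 ltac:(ring) ltac:(ring) (Hnd _ _)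
    (fun k Hk => Hquad _ _ (-1) 1 k Hk (Hneg _) (Hpos _)) (HlS _ _)).
  assert (B4 := Hpart (-1) (-1) L4 ltac:(ring) ltac:(ring) (Hnd _ _)
    (fun k Hk => Hquad _ _ (-1) (-1) k Hk (Hneg _) (Hneg _)) (HlS _ _)).
  (* The total constant is [4 * 64 * 180000 * 10368], about [4.8 * 10^11], below [1000^4]. *)
  unfold X; rewrite !lsum_app.
  assert (0 <= M ^ 2 * S ^ 2) by (apply Rmult_le_pos; apply pow2_ge_0).
  lra.
Qed.

Theorem theorem1 :
  exists C : R, 0 < C /\
  forall (Rad : R) (n : nat) (xi : nat -> R * R) (u v : nat -> R),
    0 < Rad ->
    (forall k, (k < n)%nat -> norm2 (xi k) = Rad) ->
    (forall j k, (j < n)%nat -> (k < n)%nat -> xi j = xi k -> j = k) ->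
    forall c1 c2 t : R,
      sqrt (sqrt (square_integral (expsum_abs4 n xi u v) c1 c2 t))
      <= C * sqrt (INR (maxcap n xi Rad)) * sqrt (rsum n (fun k => u k ^ 2 + v k ^ 2)).
Proof.
  exists 1000; split; [lra|].
  intros Rad n xi u v HR Hxi _ c1 c2 t.
  pose proof (square_integral_abs4_le Rad n xi u v c1 c2 t HR Hxi) as H.
  set (M := INR (maxcap n xi Rad)) in *.
  set (S := rsum n (fun k => u k ^ 2 + v k ^ 2)) in *.
  assert (HM : 0 <= M) by apply pos_INR.
  assert (HS : 0 <= S).
  { apply (lsum_nonneg (seq 0 n)); intros k _.
    apply Rplus_le_le_0_compat; apply pow2_ge_0. }
  (* The bound is the square of [1000^2 * M * S], whose own root is [1000 * sqrt M * sqrt S]. *)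
  apply Rle_trans with (sqrt (sqrt ((1000 ^ 2 * M * S)²))).
  - do 2 apply sqrt_le_1_alt; unfold Rsqr; lra.
  - rewrite sqrt_Rsqr by (repeat apply Rmult_le_pos; lra).
    rewrite !sqrt_mult, sqrt_pow2 by (repeat apply Rmult_le_pos; lra); lra.
Qed.
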